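(* There is an infinite family of (pairwise non-isomorphic) connected cubic graphs $G$ such that $\chi_s'(G) = 5$ and $\chi_{s,l}'(G) > 5$.
   Context: Graphs are finite and simple; a cubic graph is a $3$-regular graph. The distance between two edges of a graph $G$ is the distance between the corresponding vertices in the line graph of $G$; so two adjacent edges are at distance $1$, and two non-adjacent edges that are both adjacent to a common edge are at distance $2$. A strong edge-coloring of $G$ is an assignment of colors to the edges of $G$ in which any two distinct edges at distance at most $2$ receive distinct colors. The strong chromatic index $\chi_s'(G)$ is the least number of colors for which $G$ admits a strong edge-coloring. A list assignment $L$ for $G$ assigns to each edge $e$ of $G$ a list (set) $L(e)$ of possible colors. $G$ is strong $L$-edge-colorable if it admits a strong edge-coloring $\varphi$ with $\varphi(e)\in L(e)$ for every $e\in E(G)$. $G$ is strong $k$-edge-choosable if it is strong $L$-edge-colorable for every list assignment $L$ with $|L(e)|\ge k$ for every $e\in E(G)$. The list strong chromatic index $\chi_{s,l}'(G)$ is the least $k$ such that $G$ is strong $k$-edge-choosable. *)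

(* Defs.v *)
From mathcomp Require Import all_boot finmap boolp.

Set Implicit Arguments.
Unset Strict Implicit.
Unset Printing Implicit Defensive.

Record sgraph := SGraph {
  vertex :> finType;
  adj : rel vertex;
  adj_sym : symmetric adj;
  adj_irrefl : irreflexive adj
}.

Definition cubic (G : sgraph) : Prop := forall x : G, #|[set y | adj x y]| = 3.

Definition connected (G : sgraph) : Prop :=
  (0 < #|G|) /\ forall x y : G, connect (@adj G) x y.

Definition isomorphic (G H : sgraph) : Prop :=
  exists f : G -> H, bijective f /\ forall x y : G, adj (f x) (f y) = adj x y.

Definition walk (G : sgraph) (x y : G) (n : nat) : bool :=
  [exists p : n.-tuple G, path (@adj G) x p && (last x p == y)].

(* [None] stands for infinite distance (x and y in different components). *)
Definition dist (G : sgraph) (x y : G) : option nat :=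
  if pselect (exists n, walk x y n) is left ex then Some (ex_minn ex) else None.

Definition dist_le (G : sgraph) (x y : G) (n : nat) : bool :=
  if dist x y is Some d then d <= n else false.

Lemma dist_leP (G : sgraph) (x y : G) n :
  reflect (exists2 m, m <= n & walk x y m) (dist_le x y n).
Proof.
apply: (iffP idP); rewrite /dist_le /dist; case: pselect => [ex|nex] //.
- by case: ex_minnP => m w _ le_mn; exists m.
- by case: ex_minnP => d _ min [m le_mn /min]; move/leq_trans; apply.
- by case=> m _ w; case: nex; exists m.
Qed.

Definition edges (G : sgraph) : {set {set G}} :=
  [set [set p.1; p.2] | p : G * G & adj p.1 p.2].

Definition edge (G : sgraph) : finType := {e : {set G} | e \in edges G}.

Definition line_adj (G : sgraph) : rel (edge G) :=
  fun e f => (e != f) && (val e :&: val f != set0).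

Lemma line_adj_sym (G : sgraph) : symmetric (@line_adj G).
Proof. by move=> e f; rewrite /line_adj eq_sym setIC. Qed.

Lemma line_adj_irrefl (G : sgraph) : irreflexive (@line_adj G).
Proof. by move=> e; rewrite /line_adj eqxx. Qed.

Definition line_graph (G : sgraph) : sgraph :=
  SGraph (@line_adj_sym G) (@line_adj_irrefl G).

Definition edge_dist_le (G : sgraph) (e f : edge G) (n : nat) : bool :=
  @dist_le (line_graph G) e f n.

Definition strong_edge_coloring (G : sgraph) (C : Type) (c : edge G -> C) : Prop :=
  forall e f : edge G, e <> f -> edge_dist_le e f 2 -> c e <> c f.

Definition strong_edge_colorable (G : sgraph) (k : nat) : Prop :=
  exists c : edge G -> 'I_k, strong_edge_coloring c.

Definition strong_list_edge_colorable (G : sgraph) (C : choiceType)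
    (L : edge G -> {fset C}) : Prop :=
  exists c : edge G -> C,
    strong_edge_coloring c /\ forall e, (c e \in L e)%fset.

Definition strong_edge_choosable (G : sgraph) (k : nat) : Prop :=
  forall (C : choiceType) (L : edge G -> {fset C}),
    (forall e, k <= #|` L e|) -> strong_list_edge_colorable L.

Lemma injective_strong (G : sgraph) (C : Type) (c : edge G -> C) :
  injective c -> strong_edge_coloring c.
Proof. by move=> inj_c e f nef _ /inj_c. Qed.

Lemma ex_strong_edge_colorable (G : sgraph) :
  exists k, `[< strong_edge_colorable G k >].
Proof.
exists #|edge G|; apply/asboolP; exists enum_rank.
exact/injective_strong/enum_rank_inj.
Qed.

Lemma ex_strong_edge_choosable (G : sgraph) :
  exists k, `[< strong_edge_choosable G k >].
Proof.
exists #|edge G|; apply/asboolP => C L sizeL.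
suff rep (s : seq (edge G)) : uniq s -> exists c : edge G -> C,
    {in s &, injective c} /\ forall e, (c e \in L e)%fset.
  have [c [inj_c Lc]] := rep _ (enum_uniq (edge G)).
  by exists c; split=> //; apply: injective_strong => e f; apply: inj_c;
    rewrite mem_enum.
elim: s => [_ | x s IHs /= /andP[xNs /[dup] uniq_s /IHs [c [inj_c Lc]]]].
  have /choice [c Lc] : forall e, exists a, (a \in L e)%fset.
    move=> e; have : (0 < #|` L e|)%N.
      by apply: leq_trans (sizeL e); apply/card_gt0P; exists e.
    by rewrite cardfs_gt0 => /fset0Pn.
  by exists c.
have [y Lxy yNc] : exists2 y, (y \in L x)%fset & y \notin map c s.
  apply/not_exists2P => noy.
  have sub : {subset L x <= map c s}.
    by move=> y Ly; case: (noy y) => // /negP; rewrite negbK.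
  have := uniq_leq_size (fset_uniq (L x)) sub.
  rewrite size_map => /(leq_trans (sizeL x)); apply/negP; rewrite -ltnNge.
  have /card_uniqP /= <- : uniq (x :: s) by rewrite /= xNs.
  exact: max_card.
exists (fun e => if e == x then y else c e); split; last first.
  by move=> e; case: eqP => [-> | _].
move=> e f; rewrite !inE.
case: (eqVneq e x) => [-> _ | _ /= es]; case: (eqVneq f x) => [-> // | _ /= fs].
- by move=> eyc; rewrite eyc map_f in yNc.
- by move=> _ eyc; rewrite -eyc map_f in yNc.
- exact: inj_c.
Qed.

Definition strong_chromatic_index (G : sgraph) : nat :=
  ex_minn (ex_strong_edge_colorable G).

Definition list_strong_chromatic_index (G : sgraph) : nat :=
  ex_minn (ex_strong_edge_choosable G).

(* Main.v *)
Require Import Defs.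
From mathcomp Require Import all_boot.
From mathcomp Require Import finmap boolp.

Set Implicit Arguments.
Unset Strict Implicit.
Unset Printing Implicit Defensive.

(** The graphs are cyclic covers of the Petersen graph [P]: take any number of
    copies of [P] with one edge [uv] deleted, and join the vertex [u] of each copy
    to the vertex [v] of the next ([petersen_cover]). These covers are connected
    and cubic, and they are told apart by their orders.

    Five colours suffice because a strong colouring pulls back along a covering
    map ([strong_edge_colorable_pullback]) and [P] has one in five colours: view
    the vertices as the two-element subsets of a five-element set, adjacent when
    disjoint, and colour an edge with the element missing from both ends. Five
    colours are needed in every cubic graph, as an edge and its four neighbours
    are pairwise at distance at most two ([cubic_strong_colors]).

    For the lists, let [e = uv], [f], [g] be the three edges of [P] that share
    the colour of [uv]. Each edge of [P] lies in exactly one of the parts formed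
    by [e], [f], [g] and their neighbours, and each part has one edge of every
    colour. Take eight list colours, split into groups of two, three and three
    colours, and give the edges of the parts of [e], [f], [g] the lists that omit
    the first, second and third group, respectively. All lists have at least five
    elements. Look at one copy of [P] without [uv]. Its edges of [P]-colour [i] are
    [X i] and [Y i] in the parts of [f] and [g] and, unless [i] is the colour of
    [uv], [Z i] in the part of [e]. Edges of different [P]-colours are at distance
    at most two, except that some pairs [Z i], [Z j] may not be ([cut_near]).
    The five pairs [X i], [Y i] hence receive disjoint sets of colours, and [X i],
    [Y i] can agree only on one of the two colours of the first group. So at most
    two pairs agree; as only eight colours are available, exactly two do, and no
    colour is left over. One of these two pairs comes with an edge [Z i], whose
    list omits the common colour of the pair, while every other colour is already
    used on an edge at distance at most two from [Z i] ([pairs_exhaust]).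
    The edges [Z i] need no comparison with each other, which is why the argument
    survives the deletion of [uv]. *)

(** * Edges and their distance *)

Section Edges.
Variable G : sgraph.
Implicit Types (x y : G) (E F : edge G).

Lemma mem_edges x y : adj x y -> [set x; y] \in edges G.
Proof. by move=> xy; apply/imsetP; exists (x, y); rewrite ?inE. Qed.

Definition mk_edge x y (xy : adj x y) : edge G := Sub [set x; y] (mem_edges xy).

Lemma edge_ends_ex E : exists p : G * G, adj p.1 p.2 && (val E == [set p.1; p.2]).
Proof.
case/imsetP: (valP E) => p + ->; rewrite inE => xy.
by exists p; rewrite xy eqxx.
Qed.

Definition edge_ends E : G * G := xchoose (edge_ends_ex E).

Lemma edge_endsP E :
  adj (edge_ends E).1 (edge_ends E).2 /\
  val E = [set (edge_ends E).1; (edge_ends E).2].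
Proof. by have /andP[? /eqP] := xchooseP (edge_ends_ex E). Qed.

Lemma edgeP E p : p \in val E -> exists2 q, adj p q & val E = [set p; q].
Proof.
have [xy ->] := edge_endsP E; rewrite !inE => /orP[] /eqP ->.
  by exists (edge_ends E).2.
by exists (edge_ends E).1; [rewrite adj_sym | rewrite setUC].
Qed.

Definition edge_fun (T : Type) (g : G -> G -> T) E : T :=
  g (edge_ends E).1 (edge_ends E).2.

(** A symmetric function of the two ends does not see which end the choice of
    [edge_ends] puts first. *)
Lemma edge_funE (T : Type) (g : G -> G -> T) E x y :
  (forall a b, g a b = g b a) -> val E = [set x; y] -> edge_fun g E = g x y.
Proof.
move=> symg; have [] := edge_endsP E; rewrite /edge_fun.
case: (edge_ends E) => a b /= ab -> eqE.
have nab : a != b by apply: contraTneq ab => ->; rewrite adj_irrefl.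
have := set21 a b; have := set22 a b; rewrite eqE !inE.
case/pred2P=> eqb /pred2P[] eqa; subst a b; rewrite ?eqxx // in nab *.
Qed.

Definition near E F : Prop :=
  exists p r, [/\ p \in val E, r \in val F & (p == r) || adj p r].

(** A shortest path of length two in the line graph runs through an edge joining
    an end of the first edge to an end of the last. *)
Lemma edge_dist_le2P E F : edge_dist_le E F 2 <-> near E F.
Proof.
have share e f : line_adj e f -> exists2 p, p \in val e & p \in val f.
  by case/andP=> _ /set0Pn[p /setIP[]]; exists p.
split.
  case/dist_leP=> m + /existsP[[p /= /eqP sz_p] /andP[]].
  case: m sz_p => [|[|[|//]]]; case: p => [|H [|F' [|]]] //= _ _.
  - move=> _ /eqP <-; have [_ eqE] := edge_endsP E.
    by exists (edge_ends E).1, (edge_ends E).1; rewrite eqE set21 eqxx.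
  - case/andP=> /share[p pE pH] _ /eqP <-.
    by exists p, p; rewrite eqxx.
  - case/and3P=> /share[p pE pH] /share[r rH rF] _ /eqP <-.
    exists p, r; split=> //; have [q pq eqH] := edgeP pH.
    by move: rH; rewrite eqH !inE => /orP[]/eqP ->; rewrite ?eqxx ?pq ?orbT.
have walk_le m (p : m.-tuple (line_graph G)) : m <= 2 ->
    path (@line_adj G) E p -> last E p = F -> edge_dist_le E F 2.
  move=> le_m path_p last_p; apply/dist_leP; exists m => //.
  by apply/existsP; exists p; rewrite path_p last_p eqxx.
have common p : p \in val E -> p \in val F -> edge_dist_le E F 2.
  move=> pE pF; have [eqEF|neq] := eqVneq E F; first exact: (walk_le 0 [tuple]).
  apply: (walk_le 1 [tuple F : line_graph G]) => //=.
  by rewrite /line_adj neq andbT; apply/set0Pn; exists p; rewrite inE pE.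
case=> p [r [pE rF /predU1P[eq_pr | pr]]].
  by apply: common pE _; rewrite eq_pr.
pose H := mk_edge pr.
have pH : p \in val H by rewrite set21.
have rH : r \in val H by rewrite set22.
have [eqH|neqE] := eqVneq E H; first by apply: (@common r) => //; rewrite eqH.
have [eqH|neqF] := eqVneq H F; first by apply: (@common p) => //; rewrite -eqH.
apply: (walk_le 2 [tuple H : line_graph G; F]) => //=.
rewrite /line_adj neqE neqF andbT; apply/andP; split.
  by apply/set0Pn; exists p; rewrite inE pE.
by apply/set0Pn; exists r; rewrite inE rH.
Qed.

Definition incident x : {set edge G} := [set E : edge G | x \in val E].

Lemma card_incident x : #|incident x| = #|[set y | adj x y]|.
Proof.
have inj : {in [set y | adj x y] &, injective (fun y => [set x; y])}.
  move=> y z; rewrite !inE => xy xz eqS.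
  have := set22 x y; rewrite eqS !inE => /predU1P[eqx|/eqP //].
  by rewrite eqx adj_irrefl in xy.
rewrite -(card_in_imset inj) -(card_imset _ val_inj); apply: eq_card => S.
apply/imsetP/imsetP=> [[E + ->]|[y]]; rewrite inE.
  by case/edgeP=> y xy ->; exists y; rewrite ?inE.
by move=> xy ->; exists (mk_edge xy); rewrite ?inE ?eqxx.
Qed.

(** The five edges meeting a given edge are pairwise at distance at most two. *)
Lemma cubic_strong_colors k :
  0 < #|G| -> cubic G -> strong_edge_colorable G k -> 5 <= k.
Proof.
case/card_gt0P=> x _ cubG [c strong_c].
have /card_gt0P[y yN] : 0 < #|[set y | adj x y]| by rewrite cubG.
have xy : adj x y by rewrite inE in yN.
have nyx : (y == x) = false by apply: contraTF xy => /eqP->; rewrite adj_irrefl.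
pose S := incident x :|: incident y.
have cap : incident x :&: incident y = [set mk_edge xy].
  apply/setP=> E; rewrite !inE; apply/andP/eqP => [[/edgeP[z xz eqE]] | ->].
    rewrite eqE !inE nyx => /eqP eqz.
    by apply: val_inj; rewrite eqE -eqz.
  by rewrite /= set21 set22.
have card_S : #|S| = 5.
  by rewrite cardsU cap cards1 !card_incident !cubG.
have inj_c : {in S &, injective c}.
  move=> E F ES FS eq_c; apply: contrapT => neq.
  apply: (strong_c E F neq) eq_c; apply/edge_dist_le2P.
  move: ES FS; rewrite !inE => /orP[] hE /orP[] hF;
    [exists x, x | exists x, y | exists y, x | exists y, y];
    by rewrite ?hE ?hF ?eqxx ?xy ?orbT // adj_sym xy orbT.
by rewrite -card_S -(card_in_imset inj_c) -[k in _ <= k]card_ord max_card.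
Qed.

End Edges.

Lemma strong_chromatic_index_eq (G : sgraph) k :
  strong_edge_colorable G k ->
  (forall m, strong_edge_colorable G m -> k <= m) ->
  strong_chromatic_index G = k.
Proof.
move=> colk mink; rewrite /strong_chromatic_index.
case: ex_minnP => m /asboolP colm minm; apply/eqP; rewrite eqn_leq mink //.
by rewrite minm //; apply/asboolP.
Qed.

Lemma list_strong_chromatic_index_gt (G : sgraph) k :
  ~ strong_edge_choosable G k -> k < list_strong_chromatic_index G.
Proof.
move=> nch; rewrite /list_strong_chromatic_index.
case: ex_minnP => m /asboolP chm _; rewrite ltnNge; apply/negP => le_mk.
by apply: nch => C L sizeL; apply: chm => e; apply: leq_trans (sizeL e).
Qed.

(** * Strong colourings and coverings *)

Section Pullback.
Variables (G H : sgraph) (f : G -> H).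
Hypothesis f_adj : forall p q, adj p q -> adj (f p) (f q).
Hypothesis f_inj : forall p q r, adj p q -> adj p r -> f q = f r -> q = r.

Lemma edge_image_mem (E : edge G) : f @: val E \in edges H.
Proof.
have [xy ->] := edge_endsP E; rewrite imsetU1 imset_set1.
exact/mem_edges/f_adj.
Qed.

Definition edge_image (E : edge G) : edge H := Sub (f @: val E) (edge_image_mem E).

(** Local injectivity prevents two distinct edges at distance at most two from
    having the same image. *)
Lemma strong_edge_colorable_pullback k :
  strong_edge_colorable H k -> strong_edge_colorable G k.
Proof.
case=> c strong_c; exists (c \o edge_image) => E F neqEF /edge_dist_le2P nEF.
apply: strong_c; last first.
  apply/edge_dist_le2P; case: nEF => p [r [pE rF pr]].
  exists (f p), (f r); rewrite !imset_f //; split=> //.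
  by case/orP: pr => [/eqP->|/f_adj->]; rewrite ?eqxx ?orbT.
have common p : p \in val E -> p \in val F -> edge_image E <> edge_image F.
  move=> /edgeP[q pq eqE] /edgeP[s ps eqF] /(congr1 val) /=.
  rewrite eqE eqF !imsetU1 !imset_set1 => eqi; apply: neqEF.
  have := set22 (f p) (f q); rewrite eqi => /set2P[fqp|fqs].
    by have := f_adj pq; rewrite fqp adj_irrefl.
  by apply: val_inj; rewrite eqE eqF (f_inj pq ps fqs).
case: nEF => p [r [pE rF /predU1P[eqpr|pr]]].
  by apply: (common p) => //; rewrite eqpr.
have [q pq eqE] := edgeP pE; have [s rs eqF] := edgeP rF.
move=> /(congr1 val) /= eqi.
have : f r \in f @: val E by rewrite eqi imset_f.
rewrite eqE imsetU1 imset_set1 => /set2P[frp|frq].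
  by have := f_adj pr; rewrite frp adj_irrefl.
have eqrq := f_inj pr pq frq.
apply: (common r) => //; last exact/val_inj.
by rewrite eqE eqrq set22.
Qed.

End Pullback.

Section CyclicCover.
Variables (H : sgraph) (u v : H) (n : nat).
Implicit Types (x y : H) (i j : 'I_n.+1).

(** The action on sheets of the voltage assignment that is one on [uv] and zero
    on all edges other than [uv]. *)
Definition sheet x y i : 'I_n.+1 :=
  if (x, y) == (u, v) then ordS i
  else if (x, y) == (v, u) then ord_pred i else i.

Lemma sheetK x y : x != y -> cancel (sheet x y) (sheet y x).
Proof.
rewrite /sheet !xpair_eqE => nxy i.
case: (eqVneq x u) => [eqx|_]; case: (eqVneq y v) => [eqy|_] /=;
case: (eqVneq x v) => [eqx'|_]; case: (eqVneq y u) => [eqy'|_] //=;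
rewrite ?ordSK ?ord_predK //; subst; rewrite ?eqxx // in nxy.
Qed.

Definition cover_adj : rel (H * 'I_n.+1) :=
  fun p q => adj p.1 q.1 && (q.2 == sheet p.1 q.1 p.2).

Lemma cover_adj_sym : symmetric cover_adj.
Proof.
move=> p q; rewrite /cover_adj [in RHS]adj_sym.
case pq: (adj p.1 q.1) => //=.
have npq : p.1 != q.1 by apply: contraTneq pq => ->; rewrite adj_irrefl.
by apply/eqP/eqP => ->; rewrite sheetK // eq_sym.
Qed.

Lemma cover_adj_irrefl : irreflexive cover_adj.
Proof. by move=> p; rewrite /cover_adj adj_irrefl. Qed.

Definition cyclic_cover : sgraph := SGraph cover_adj_sym cover_adj_irrefl.

Lemma cover_proj_adj (p q : cyclic_cover) : adj p q -> adj p.1 q.1.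
Proof. by case/andP. Qed.

Lemma cover_proj_inj (p q r : cyclic_cover) :
  adj p q -> adj p r -> q.1 = r.1 -> q = r.
Proof.
case: q r => [y j] [z k] /andP[_ /eqP /= ->] /andP[_ /eqP /= ->] -> //.
Qed.

Lemma cover_cubic : cubic H -> cubic cyclic_cover.
Proof.
move=> cubH [x i]; rewrite -(cubH x).
have inj : injective (fun y => (y, sheet x y i) : cyclic_cover) by move=> y z [].
rewrite -(card_imset _ inj); apply: eq_card => -[y j].
rewrite inE; apply/andP/imsetP => [[/= xy /eqP ->]|[z]].
  by exists y; rewrite ?inE.
by rewrite inE => xz [-> ->]; rewrite eqxx.
Qed.

Definition cut_adj : rel H :=
  fun x y => [&& adj x y, (x, y) != (u, v) & (x, y) != (v, u)].

Lemma cut_adj_cover x y i : cut_adj x y -> @adj cyclic_cover (x, i) (y, i).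
Proof.
case/and3P=> xy /negPf nuv /negPf nvu.
by rewrite /= /cover_adj /sheet xy nuv nvu /=.
Qed.

(** Each sheet is a connected copy of [H] without [uv], and the lifts of [uv]
    join the sheets in a cycle. *)
Lemma cover_connected :
  adj u v -> (forall x, connect cut_adj x u) -> connected cyclic_cover.
Proof.
move=> uv conn_u.
have sym : connect_sym (@adj cyclic_cover).
  exact/sym_connect_sym/(@adj_sym cyclic_cover).
have in_sheet x i : connect (@adj cyclic_cover) (x, i) (u, i).
  case/connectP: (conn_u x) => s + ->; elim: s x => [|y s IHs] x //=.
  case/andP=> xy /IHs; apply: connect_trans.
  exact/connect1/cut_adj_cover.
have next i : connect (@adj cyclic_cover) (u, i) (u, ordS i).
  apply: connect_trans (in_sheet v _); apply: connect1.
  by rewrite /= /cover_adj /sheet !eqxx uv.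
have to0 x i : connect (@adj cyclic_cover) (x, i) (u, ord0).
  apply: connect_trans (in_sheet x i) _; rewrite sym.
  case: i => k; elim: k => [|k IHk] lt_k.
    by rewrite (_ : Ordinal _ = ord0) //; apply: val_inj.
  apply: connect_trans (IHk (ltnW lt_k)) _.
  rewrite (_ : Ordinal lt_k = ordS (Ordinal (ltnW lt_k))) //.
  by apply: val_inj; rewrite /= modn_small.
split; first by apply/card_gt0P; exists (u, ord0).
by case=> x i [y j]; apply: connect_trans (to0 x i) _; rewrite sym.
Qed.

Lemma card_cyclic_cover : #|cyclic_cover| = #|H| * n.+1.
Proof. by rewrite card_prod card_ord. Qed.

End CyclicCover.

(** * The Petersen graph *)

(** The vertices are numbered by [0, ..., 9], so that facts about them can be
    checked by computation; [label] gives the two-element subset of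
    [{0, ..., 4}] that a vertex stands for. *)
Definition label (x : nat) : seq nat :=
  nth [::] [:: [:: 0; 1]; [:: 2; 3]; [:: 0; 2]; [:: 1; 3]; [:: 0; 3];
               [:: 1; 2]; [:: 0; 4]; [:: 1; 4]; [:: 2; 4]; [:: 3; 4]] x.

Definition disjoint_labels (x y : nat) : bool := ~~ has (mem (label x)) (label y).

Lemma all_ord n (P : pred nat) : all P (iota 0 n) -> forall x : 'I_n, P x.
Proof. by move/allP=> allP x; apply: allP; rewrite mem_iota ltn_ord. Qed.

Lemma all_ord2 n (P : nat -> nat -> bool) :
  all (fun x => all (P x) (iota 0 n)) (iota 0 n) -> forall x y : 'I_n, P x y.
Proof. by move=> allP x; apply: all_ord; apply: (all_ord allP). Qed.

Lemma all_ord4 n (P : nat -> nat -> nat -> nat -> bool) :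
  all (fun x => all (fun y => all (fun z => all (P x y z) (iota 0 n))
    (iota 0 n)) (iota 0 n)) (iota 0 n) ->
  forall x y z t : 'I_n, P x y z t.
Proof. by move=> allP x y; apply: all_ord2; apply: (all_ord2 allP). Qed.

Lemma petersen_adj_sym : symmetric (fun x y : 'I_10 => disjoint_labels x y).
Proof. by move=> x y; rewrite /disjoint_labels has_sym. Qed.

Lemma petersen_adj_irrefl : irreflexive (fun x y : 'I_10 => disjoint_labels x y).
Proof.
move=> x; apply/negbTE.
by apply: (all_ord (P := fun x => ~~ disjoint_labels x x)).
Qed.

Definition petersen : sgraph := SGraph petersen_adj_sym petersen_adj_irrefl.

Lemma petersen_cubic : cubic petersen.
Proof.
move=> x; rewrite cardsE -sum1_card big_mkcond /=.
under eq_bigr => y _ do rewrite unfold_in /=.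
rewrite -(big_mkord xpredT (fun y => if disjoint_labels x y then 1 else 0)).
apply/eqP; move: x.
pose deg x := \sum_(0 <= y < 10) (if disjoint_labels x y then 1 else 0).
by apply: (all_ord (P := fun x => deg x == 3)); rewrite /deg unlock.
Qed.

(** The edge joining [x] and [y] is coloured with the label occurring in neither
    of its ends; all five labels add up to [10]. *)
Definition edge_label (x y : nat) : nat := 10 - (sumn (label x) + sumn (label y)).

Lemma edge_labelC x y : edge_label x y = edge_label y x.
Proof. by rewrite /edge_label addnC. Qed.

Lemma edge_label_lt (x y : 'I_10) : disjoint_labels x y -> edge_label x y < 5.
Proof.
apply/implyP; move: x y.
apply: (all_ord2 (P := fun x y => disjoint_labels x y ==> (edge_label x y < 5))).
by vm_compute.
Qed.

(** The label of [xy] is outside [y] and, as [x] and [z] are different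
    two-element subsets of the complement of [y], it lies in [z]; the label of
    [zt] does not. For [t = y] this concerns adjacent edges. *)
Lemma edge_label_path (x y z t : 'I_10) :
  disjoint_labels x y -> disjoint_labels y z -> disjoint_labels z t ->
  x != z -> edge_label x y != edge_label z t.
Proof.
rewrite -(inj_eq val_inj) /= => xy yz zt nxz.
pose P x y z t := [&& disjoint_labels x y, disjoint_labels y z,
    disjoint_labels z t & x != z] ==> (edge_label x y != edge_label z t).
have : P x y z t by apply: all_ord4; vm_compute.
by rewrite /P xy yz zt nxz.
Qed.

Definition petersen_color : edge petersen -> 'I_5 :=
  edge_fun (fun x y : petersen => inord (edge_label x y)).

Lemma petersen_colorE (x y : petersen) (E : edge petersen) :
  adj x y -> val E = [set x; y] -> petersen_color E = edge_label x y :> nat.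
Proof.
move=> xy eqE; rewrite /petersen_color (edge_funE _ eqE) => [|a b].
  by rewrite inordK ?edge_label_lt.
by rewrite edge_labelC.
Qed.

Lemma petersen_strong_colorable : strong_edge_colorable petersen 5.
Proof.
exists petersen_color.
have common (p : petersen) (E F : edge petersen) : E <> F ->
    p \in val E -> p \in val F -> petersen_color E <> petersen_color F.
  move=> neqEF /edgeP[q pq eqE] /edgeP[s ps eqF] /(congr1 val) /=.
  rewrite (petersen_colorE pq) // (petersen_colorE ps) //.
  rewrite edge_labelC [edge_label p s]edge_labelC.
  apply/eqP/edge_label_path; rewrite //.
    by rewrite -[disjoint_labels _ _]/(adj q p) adj_sym.
    by rewrite -[disjoint_labels _ _]/(adj s p) adj_sym.
  by apply/eqP=> eqqs; apply: neqEF; apply: val_inj; rewrite eqE eqF eqqs.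
move=> E F neqEF /edge_dist_le2P[p [r [pE rF /predU1P[eqpr|pr]]]].
  by apply: (common p) => //; rewrite eqpr.
have [q pq eqE] := edgeP pE; have [s rs eqF] := edgeP rF.
have [eqqr|nqr] := eqVneq q r.
  by apply: (common r) => //; rewrite eqE eqqr set22.
move=> /(congr1 val) /=; rewrite (petersen_colorE pq) // (petersen_colorE rs) //.
rewrite edge_labelC; apply/eqP/edge_label_path => //.
by rewrite adj_sym in pq.
Qed.

(** * A list assignment without a strong colouring *)

(** The coincidences [X i = Y i] use distinct elements of [C], so there are at
    most two. The pairs thus take at least [2 * #|I| - 2] values, so they exhaust
    [K] and there are exactly two coincidences. At one of them [i != i0], and there
    [Z i] must be a value of the pair [i] itself; but this value lies in [C]. *)
Lemma pairs_exhaust (I K : finType) (i0 : I) (C : {set K}) (X Y Z : I -> K) :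
  #|K|.+2 <= 2 * #|I| -> #|C| <= 2 ->
  injective X -> injective Y ->
  (forall i j, X i = Y j -> i = j) ->
  (forall i, X i = Y i -> X i \in C) ->
  (forall i, i != i0 -> Z i \notin C) ->
  (forall i j, i != i0 -> Z i = X j \/ Z i = Y j -> i = j) ->
  False.
Proof.
move=> cardK cardC injX injY XY XYC ZC ZXY.
pose D := [set i | X i == Y i]; pose U := X @: setT :|: Y @: setT.
have capE : X @: setT :&: Y @: setT = X @: D.
  apply/setP=> k; rewrite inE; apply/andP/imsetP.
    case=> /imsetP[i _ ->] /imsetP[j _ eqk].
    by exists i; rewrite // inE {2}(XY _ _ eqk) eqk.
  by case=> i; rewrite inE => /eqP eqi ->; split; [|rewrite eqi]; rewrite imset_f.
have leD : #|D| <= 2.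
  apply: leq_trans cardC; rewrite -(card_imset _ injX); apply: subset_leq_card.
  by apply/subsetP=> k /imsetP[i]; rewrite inE => /eqP eqi ->; apply: XYC.
have cardU : #|U| + #|D| = 2 * #|I|.
  by rewrite -(card_imset D injX) -capE cardsUI !card_imset // cardsT mul2n addnn.
have UT : U = setT.
  apply/eqP; rewrite eqEcard subsetT cardsT.
  by rewrite -(leq_add2r 2) addn2 (leq_trans cardK) // -cardU leq_add2l.
have geD : 2 <= #|D|.
  by rewrite -(leq_add2l #|K|) addn2 -[X in _ <= X + _]cardsT -UT cardU.
have /card_gt0P[i] : 0 < #|D :\ i0|.
  rewrite lt0n; apply: contraTneq geD => cardD'.
  by rewrite (cardsD1 i0) cardD' addn0 -ltnNge ltnS leq_b1.
rewrite !inE => /andP[ni0 /eqP eqi].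
have ZiX : Z i = X i.
  have : Z i \in U by rewrite UT.
  rewrite inE => /orP[] /imsetP[j _ eqZ]; have eqij : i = j by apply: ZXY; auto.
    by rewrite eqZ eqij.
  by rewrite eqZ eqi eqij.
by have := ZC i ni0; rewrite ZiX XYC.
Qed.

(** The edges of colour [4] join the vertices numbered [0] and [1], [2] and [3],
    [4] and [5], and no other edge joins two of these six vertices. The remaining
    vertices all contain the label [4], so they are pairwise non-adjacent. Hence
    every other edge has exactly one end below [6], which tells the edge of
    colour [4] that it touches. *)
Definition part (x y : nat) : nat := (minn x y)./2.

Lemma partC x y : part x y = part y x.
Proof. by rewrite /part minnC. Qed.

(** This makes groups [0], [1], [2] of two, three and three of the colours
    [0, ..., 7]; the group that only the part of the deleted edge avoids has to be
    the small one. *)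
Definition color_group (c : nat) : nat := c.+1 %/ 3.

Definition part_list (k : nat) : {fset 'I_8} :=
  [fset c in enum [pred c : 'I_8 | color_group c != k]]%fset.

Lemma mem_part_list k (c : 'I_8) : (c \in part_list k) = (color_group c != k).
Proof. by rewrite inE /= mem_enum inE. Qed.

Lemma card_part_list k : 5 <= #|` part_list k|.
Proof.
rewrite card_fseq undup_id ?enum_uniq // -cardE -sum1_card big_mkcond /=.
by rewrite !big_ord_recl big_ord0 /color_group !inE /=; case: k => [|[|[|k]]].
Qed.

Definition petersen0 : petersen := inord 0.
Definition petersen1 : petersen := inord 1.

Definition petersen_cover (n : nat) : sgraph := cyclic_cover petersen0 petersen1 n.

(** [cut_adj petersen0 petersen1] in computable form. *)
Definition cut_link (x y : nat) : bool :=
  [&& disjoint_labels x y, (x, y) != (0, 1) & (x, y) != (1, 0)].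

Lemma cut_linkE (x y : petersen) : cut_adj petersen0 petersen1 x y = cut_link x y.
Proof.
by rewrite /cut_adj /cut_link !xpair_eqE -!(inj_eq val_inj) /= !inordK.
Qed.

(** In the Petersen graph, edges of different colours are at distance at most
    two. A connection of length two runs through the deleted edge only if both
    edges are neighbours of it, that is, in part [0]. *)
Lemma cut_near (x y z t : 'I_10) :
  cut_link x y -> cut_link z t -> edge_label x y != edge_label z t ->
  (0 < part x y) || (0 < part z t) ->
  exists p r : 'I_10,
    [/\ p \in [set x; y], r \in [set z; t] & (p == r) || cut_link p r].
Proof.
move=> xy zt nc np.
pose link p r := (p == r) || cut_link p r.
pose P x y z t := [&& cut_link x y, cut_link z t, edge_label x y != edge_label z t
    & (0 < part x y) || (0 < part z t)] ==>
  [|| link x z, link x t, link y z | link y t].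
have : P x y z t by apply: all_ord4; vm_compute.
rewrite /P xy zt nc np /= => /or4P[] near;
  [exists x, z | exists x, t | exists y, z | exists y, t];
  by rewrite !inE !eqxx ?orbT.
Qed.

Lemma cut_connected (x : petersen) :
  connect (cut_adj petersen0 petersen1) x petersen0.
Proof.
pose fix reach m x {struct m} := (x == 0) ||
  (if m is m'.+1 then has (fun y => cut_link x y && reach m' y) (iota 0 10)
   else false).
have reachP m (y : petersen) : reach m y ->
    connect (cut_adj petersen0 petersen1) y petersen0.
  have base (z : petersen) : z == 0 :> nat ->
      connect (cut_adj petersen0 petersen1) z petersen0.
    move=> /eqP z0; rewrite (_ : z = petersen0) //.
    by apply: val_inj; rewrite /= inordK.
  elim: m y => [|m IHm] y /orP[/base|] //.
  case/hasP=> z; rewrite mem_iota => lt_z /andP[yz /(IHm (Ordinal lt_z))].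
  by apply: connect_trans; apply: connect1; rewrite cut_linkE.
(* Without the edge [01], every vertex is still within distance four of [0]. *)
by apply: (reachP 4); move: x; apply: all_ord; vm_compute.
Qed.

Lemma part_edge_exists k (i : 'I_5) : k < 3 -> (0 < k) || (i != ord_max) ->
  exists x y : 'I_10, [/\ cut_link x y, edge_label x y = i & part x y = k].
Proof.
rewrite -(inj_eq val_inj) /= => lt_k.
pose Q k i x y := [&& cut_link x y, edge_label x y == i & part x y == k].
pose P k i := ((0 < k) || (i != 4)) ==>
  has (fun x => has (Q k i x) (iota 0 10)) (iota 0 10).
have chk : all (fun k => all (P k) (iota 0 5)) (iota 0 3) by vm_compute.
have /implyP := all_ord (all_ord chk (Ordinal lt_k)) i => /[apply].
case/hasP=> x + /hasP[y]; rewrite !mem_iota => lt_x lt_y /and3P[xy /eqP ? /eqP ?].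
by exists (Ordinal lt_x), (Ordinal lt_y).
Qed.

Lemma petersen_cover_not_choosable n : ~ strong_edge_choosable (petersen_cover n) 5.
Proof.
pose lists (E : edge (petersen_cover n)) : {fset 'I_8} :=
  part_list (edge_fun (fun p q : petersen_cover n => part p.1 q.1) E).
case/(_ 'I_8 lists (fun E => card_part_list _)) => c [strong_c list_c].
pose at0 (x : petersen) : petersen_cover n := (x, ord0).
have at0_adj (x y : petersen) : cut_link x y -> adj (at0 x) (at0 y).
  by rewrite -cut_linkE => xy; apply: cut_adj_cover.
pose colored (k i : nat) (a : 'I_8) := exists (x y : petersen) (xy : cut_link x y),
  [/\ edge_label x y = i, part x y = k & a = c (mk_edge (at0_adj x y xy))].
have colored_list k i a : colored k i a -> color_group a != k.
  case=> x [y [xy [_ <- ->]]]; rewrite -mem_part_list.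
  have := list_c (mk_edge (at0_adj x y xy)).
  by rewrite /lists (edge_funE (x := at0 x) (y := at0 y)) // => p q; rewrite partC.
have colored_neq k i a k' i' a' : colored k i a -> colored k' i' a' ->
    i != i' -> (0 < k) || (0 < k') -> a <> a'.
  case=> x [y [xy [<- <- ->]]] [z [t [zt [<- <- ->]]]] nc np.
  have [p [r [pxy rzt pr]]] := cut_near xy zt nc np.
  apply: strong_c.
    move=> /(congr1 (edge_fun (fun p q : petersen_cover n => edge_label p.1 q.1))).
    rewrite (edge_funE (x := at0 x) (y := at0 y)) // => [|*]; last exact: edge_labelC.
    rewrite (edge_funE (x := at0 z) (y := at0 t)) // => [|*]; last exact: edge_labelC.
    exact/eqP.
  apply/edge_dist_le2P; exists (at0 p), (at0 r); split.
  - by case/set2P: pxy => ->; rewrite ?set21 ?set22.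
  - by case/set2P: rzt => ->; rewrite ?set21 ?set22.
  - by case/predU1P: pr => [->|/at0_adj->]; rewrite ?eqxx ?orbT.
have colored_ex k : k < 3 -> exists W : 'I_5 -> 'I_8,
    forall i, (0 < k) || (i != ord_max) -> colored k i (W i).
  move=> lt_k; pose P (i : 'I_5) a := (0 < k) || (i != ord_max) -> colored k i a.
  suff /fin_all_exists : forall i, exists a, P i a by [].
  rewrite /P => i; case: (boolP ((0 < k) || _)) => [|_]; last by exists ord0.
  case/(part_edge_exists lt_k)=> x [y [xy ? ?]]; exists (c (mk_edge (at0_adj x y xy))) => _.
  by exists x, y, xy.
have [X colX] := colored_ex 1 isT; have {}colX i := colX i isT.
have [Y colY] := colored_ex 2 isT; have {}colY i := colY i isT.
have [Z /= colZ] := colored_ex 0 isT.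
have inj k i a k' i' a' : colored k i a -> colored k' i' a' ->
    (0 < k) || (0 < k') -> a = a' -> i = i'.
  move=> col col' np /eqP eqa; apply: contraTeq eqa => ni.
  exact/eqP/(colored_neq _ _ _ _ _ _ col col').
apply: (@pairs_exhaust _ _ ord_max [set a : 'I_8 | color_group a == 0] X Y Z).
- by rewrite !card_ord.
- by rewrite -sum1_card big_mkcond /= !big_ord_recl big_ord0 !inE.
- by move=> i j /(inj _ _ _ _ _ _ (colX i) (colX j) isT)/val_inj.
- by move=> i j /(inj _ _ _ _ _ _ (colY i) (colY j) isT)/val_inj.
- by move=> i j /(inj _ _ _ _ _ _ (colX i) (colY j) isT)/val_inj.
- move=> i eqi; rewrite inE; have := colored_list _ _ _ (colX i).
  have := colored_list _ _ _ (colY i); rewrite -eqi /color_group.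
  by case: (X i) => -[|[|[|[|[|[|[|[|]]]]]]]].
- by move=> i /colZ/colored_list; rewrite inE.
- move=> i j /colZ colZi [] eqZ; apply/val_inj.
    exact: (inj _ _ _ _ _ _ colZi (colX j)).
  exact: (inj _ _ _ _ _ _ colZi (colY j)).
Qed.

Theorem theorem1p6 :
  exists G : nat -> sgraph,
    (forall i j : nat, isomorphic (G i) (G j) -> i = j) /\
    (forall i : nat,
        [/\ connected (G i), cubic (G i),
            strong_chromatic_index (G i) = 5
          & 5 < list_strong_chromatic_index (G i)]).
Proof.
exists petersen_cover; split=> [i j [f [bij_f _]] | n].
  have := bij_eq_card bij_f; rewrite !card_cyclic_cover /= card_ord.
  by move/eqP; rewrite eqn_pmul2l // => /eqP[].
have conn : connected (petersen_cover n).
  by apply: cover_connected cut_connected; rewrite /= !inordK.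
have cub : cubic (petersen_cover n) by apply/cover_cubic/petersen_cubic.
split=> //.
  apply: strong_chromatic_index_eq => [|m].
    apply: strong_edge_colorable_pullback petersen_strong_colorable.
      exact: cover_proj_adj.
    exact: cover_proj_inj.
  by case: conn => ne _; apply: cubic_strong_colors.
exact/list_strong_chromatic_index_gt/petersen_cover_not_choosable.
Qed.
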